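(* Let $\boldsymbol A(\mathfrak C)=\mathfrak C^*$ be a regular (branched or unbranched) covering of the surface complex $\mathfrak C^*$ by the connected surface complex $\mathfrak C$, let $\mathfrak K$ be the universal covering complex of $\mathfrak C$ with covering $\boldsymbol A'(\mathfrak K)=\mathfrak C$, and let $\boldsymbol A''(\mathfrak K)=\boldsymbol A(\boldsymbol A'(\mathfrak K))=\mathfrak C^*$. Then $\boldsymbol A''$ is a regular covering of $\mathfrak C^*$ by $\mathfrak K$; that is, if $w$ is a closed path of $\mathfrak K$ and $\overline w$ is a path of $\mathfrak K$ with $\boldsymbol A''(w)=\boldsymbol A''(\overline w)$, then $\overline w$ is also closed.
   Context: A line segment complex consists of (finitely or denumerably many) points and directed segments; each segment $s$ has an initial and a final point and an oppositely directed segment $s^{-1}\ne s$, with $(s^{-1})^{-1}=s$, whose initial (final) point is the final (initial) point of $s$. Paths are finite sequences of segments, each beginning where the preceding one ends. A surface complex is a line segment complex together with surface pieces $f$; each $f$ has an opposite $f^{-1}\neq f$, $(f^{-1})^{-1}=f$, and a closed path, determined up to cyclic interchange, circumscribing $f$ once positively (a simple positive boundary path of $f$); if $w$ is one for $f$, then $w^{-1}$ is one for $f^{-1}$. Covering (possibly branched) $\boldsymbol A(\mathfrak C)=\mathfrak C^*$ of surface complexes: a map of points, segments, surface pieces, surjective on points, such that (a) initial points are preserved, $\boldsymbol A(s^{-1})=\boldsymbol A(s)^{-1}$, $\boldsymbol A(f^{-1})=\boldsymbol A(f)^{-1}$, and the segments beginning at $p$ are mapped bijectively onto those beginning at $\boldsymbol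 A(p)$; (b) if $r$ is a simple positive boundary path of $f$, then $\boldsymbol A(r)={r^*}^k$ for a simple positive boundary path $r^*$ of $\boldsymbol A(f)$, and, writing $r=w_1\cdots w_k$ with $\boldsymbol A(w_i)=r^*$, the $w_i$ are pairwise distinct; (c) if $r^*$ is a simple positive boundary path of $f^*$ and $w'$ is a path with $\boldsymbol A(w')=r^*$, there is exactly one surface piece $f'$ over $f^*$ in whose simple positive boundary path $r'$ (suitably cyclically interchanged) $w'$ occurs as initial subpath. If $\boldsymbol A(r')={r^*}^k$, then $k-1$ is the branching number of $f'$; the covering is branched if some branching number is nonzero. In the covered complex $\mathfrak C^*$ each simple positive boundary path of a surface piece $f^*$ is assumed to bound only this surface piece positively. A covering is regular if, whenever $w,w'$ are paths with $\boldsymbol A(w)=\boldsymbol A(w')$ and $w$ is closed, $w'$ is closed; this is a condition on the line segment complexes only. The universal covering complex $\mathfrak K$ of a connected surface complex $\mathfrak C$ is the connected unbranched covering complex in which a path is closed if and only if its image in $\mathfrak C$ is closed and represents the identity of the fundamental group of $\mathfrak C$ (closed paths modulo insertion and deletion of $ss^{-1}$ and of simple boundary paths of surface pieces). *)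

(* Defs.v *)
From Stdlib Require Import Relation_Operators.
From mathcomp Require Import all_boot.

Set Implicit Arguments.
Unset Strict Implicit.
Unset Printing Implicit Defensive.

(* countType: finitely or denumerably many points and segments. *)
Record line_complex := LineComplex {
  point : countType;
  segment : countType;
  init : segment -> point;
  final : segment -> point;
  sinv : segment -> segment;
  sinvK : involutive sinv;
  sinv_neq : forall s, sinv s != s;
  init_sinv : forall s, init (sinv s) = final s;
  final_sinv : forall s, final (sinv s) = init s
}.

(* A path is the bare sequence of its segments.  The empty sequence carries no
   base point: it is a path from p to p for every point p. *)
Fixpoint walk (L : line_complex) (p : point L) (w : seq (segment L))
    (q : point L) : bool :=
  if w is s :: w' then (init s == p) && walk (final s) w' q else p == q.

Definition is_path (L : line_complex) (w : seq (segment L)) : Prop :=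
  exists p q, walk p w q.

Definition closed_path (L : line_complex) (w : seq (segment L)) : Prop :=
  exists p, walk p w p.

Definition path_inv (L : line_complex) (w : seq (segment L)) :
    seq (segment L) :=
  rev (map (@sinv L) w).

Definition path_pow (L : line_complex) (w : seq (segment L)) (k : nat) :
    seq (segment L) :=
  flatten (nseq k w).

Definition connected (L : line_complex) : Prop :=
  forall p q : point L, exists w, walk p w q.

(* [spb f r]: r is a simple positive boundary path of f.  Boundary paths have
   at least one segment, so that they have a location and the exponent k in
   A(r) = r*^k is determined. *)
Record surface_complex := SurfaceComplex {
  lines :> line_complex;
  piece : Type;
  pinv : piece -> piece;
  pinvK : involutive pinv;
  pinv_neq : forall f, pinv f <> f;
  spb : piece -> seq (segment lines) -> Prop;
  spb_ex : forall f, exists r, spb f r;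
  spb_nonempty : forall f r, spb f r -> r != [::];
  spb_closed : forall f r, spb f r -> closed_path r;
  spb_cyclic : forall f r r', spb f r -> (spb f r' <-> exists n, r' = rot n r);
  spb_inv : forall f r, spb f r -> spb (pinv f) (path_inv r)
}.

Definition bounds_uniquely (C : surface_complex) : Prop :=
  forall (f g : piece C) r, spb f r -> spb g r -> f = g.

Record complex_map (C D : surface_complex) := ComplexMap {
  on_point : point C -> point D;
  on_segment : segment C -> segment D;
  on_piece : piece C -> piece D
}.

Definition on_path (C D : surface_complex) (A : complex_map C D)
    (w : seq (segment C)) : seq (segment D) :=
  map (on_segment A) w.

Definition comp_map (C D E : surface_complex) (B : complex_map D E)
    (A : complex_map C D) : complex_map C E :=
  ComplexMap (on_point B \o on_point A) (on_segment B \o on_segment A)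
    (on_piece B \o on_piece A).

(* The field cov_star is the bijectivity of A from the segments beginning at p
   to the segments beginning at A(p). *)
Record covering (C D : surface_complex) (A : complex_map C D) : Prop :=
  Covering {
  cov_surj : forall q, exists p, on_point A p = q;
  cov_init : forall s, init (on_segment A s) = on_point A (init s);
  cov_sinv : forall s, on_segment A (sinv s) = sinv (on_segment A s);
  cov_pinv : forall f, on_piece A (pinv f) = pinv (on_piece A f);
  cov_star : forall p s', init s' = on_point A p ->
    exists! s, init s = p /\ on_segment A s = s';
  cov_boundary : forall f r, spb f r ->
    exists r' k, [/\ spb (on_piece A f) r',
      on_path A r = path_pow r' k &
      exists ws : seq (seq (segment C)),
        [/\ size ws = k, r = flatten ws,
            {in ws, forall w, on_path A w = r'} & uniq ws]];
  cov_lift : forall g r' w, spb g r' -> is_path w -> on_path A w = r' ->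
    exists! f, on_piece A f = g /\ exists r, spb f r /\ prefix w r
}.

Definition branching_number (C D : surface_complex) (A : complex_map C D)
    (f : piece C) (n : nat) : Prop :=
  exists r r', [/\ spb f r, spb (on_piece A f) r' &
    on_path A r = path_pow r' n.+1].

Definition branched (C D : surface_complex) (A : complex_map C D) : Prop :=
  exists f n, branching_number A f n /\ n <> 0.

Definition regular (C D : surface_complex) (A : complex_map C D) : Prop :=
  forall w w', is_path w -> is_path w' -> on_path A w = on_path A w' ->
    closed_path w -> closed_path w'.

(* Negative boundary paths of f are covered as positive ones of pinv f. *)
Inductive insertion (C : surface_complex) :
    seq (segment C) -> seq (segment C) -> Prop :=
| InsertSpur u v s : insertion (u ++ v) (u ++ [:: s; sinv s] ++ v)
| InsertBoundary u v f r : spb f r -> insertion (u ++ v) (u ++ r ++ v).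

Definition elementary_move (C : surface_complex) (p : point C)
    (w w' : seq (segment C)) : Prop :=
  [/\ walk p w p, walk p w' p & insertion w w'].

(* The fundamental group at p is the set of closed paths at p modulo
   [homotopic p]; its identity is the class of the empty path. *)
Definition homotopic (C : surface_complex) (p : point C) :
    seq (segment C) -> seq (segment C) -> Prop :=
  clos_refl_sym_trans _ (elementary_move p).

Definition represents_identity (C : surface_complex) (w : seq (segment C)) :
    Prop :=
  exists p : point C, walk p w p /\ homotopic p w [::].

Definition universal_covering (K C : surface_complex) (A : complex_map K C) :
    Prop :=
  [/\ connected K, covering A, ~ branched A &
      forall w, is_path w ->
        (closed_path w <->
         closed_path (on_path A w) /\ represents_identity (on_path A w))].

(* Main.v *)
From Stdlib Require Import Relation_Operators.
Require Import Defs.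
From mathcomp Require Import all_boot.

Set Implicit Arguments.
Unset Strict Implicit.
Unset Printing Implicit Defensive.

(** Everything rests on unique path lifting: for a covering, a path is
    determined by its first point and its image, and every path downstairs
    lifts from every point over its first point.

    Composite.  Since [A'] is unbranched, it maps simple boundary paths of
    pieces of [K] to simple boundary paths of pieces of [C], so the factorisation
    of a boundary path over [Cs] can be pulled back from [C] to [K].  For the
    lifting condition, a path [w] of [K] over a boundary path of a piece [g]
    determines first a piece [f] of [C] whose boundary path starts with [A' w],
    and then, by lifting the rest of that boundary path, a piece of [K] over
    [f].  Uniqueness holds because two boundary paths with the same beginning
    over [g] are both mapped to powers of the same path; when they also have the
    same length they coincide ([boundary_factor], [walk_inj]).

    Regularity.  The exponent [k] with which a boundary path [r] covers [r*] is
    the least positive number of turns around [r*] after which the lift closes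
    up, since the [k] factors of [r] are distinct.  In a regular covering closing
    up does not depend on the first point of the lift, hence any path with the
    same image as a boundary path is itself a boundary path
    ([regular_boundary]).  A contraction of a closed path of [C] can therefore be
    transported, move by move, to any other path of [C] with the same image in
    [Cs] ([homotopic_transport]).  So if [w] is closed in [K], i.e. [A' w] is
    closed and contractible, then the same holds for every path of [K] with the
    same image as [w] in [Cs]. *)

(** * Walks and powers *)

Section Walks.

Variable L : line_complex.
Implicit Types (p q m : point L) (w u v : seq (segment L)).

Lemma walk_cat p u v q :
  walk p (u ++ v) q <-> exists2 m, walk p u m & walk m v q.
Proof.
elim: u p => [|s u IH] p /=.
  split=> [h|[m /eqP-> //]]; by exists p.
split=> [/andP[-> /IH[m h1 h2]]|[m /andP[-> h1] h2]]; first by exists m.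
by apply/IH; exists m.
Qed.

Lemma walk_final p w q q' : walk p w q -> walk p w q' -> q = q'.
Proof.
elim: w p => [|s w IH] p /=; first by move=> /eqP<- /eqP.
by move=> /andP[_ h] /andP[_]; apply: IH.
Qed.

Lemma walk_init p p' w q q' :
  w != [::] -> walk p w q -> walk p' w q' -> p = p'.
Proof. by case: w => //= s w _ /andP[/eqP<- _] /andP[/eqP<-]. Qed.

Lemma size_path_pow w k : size (path_pow w k) = k * size w.
Proof. by rewrite /path_pow size_flatten /shape map_nseq sumn_nseq mulnC. Qed.

End Walks.

Lemma spb_size (C : surface_complex) (f : piece C) r r' :
  spb f r -> spb f r' -> size r = size r'.
Proof. by move=> h /(spb_cyclic _ h)[n ->]; rewrite size_rot. Qed.

(** * Path lifting *)

Section Lifting.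

Variables (C D : surface_complex) (A : complex_map C D).
Hypothesis cA : covering A.
Implicit Types (p q m : point C) (w u v : seq (segment C)).

Lemma cov_final s : final (on_segment A s) = on_point A (final s).
Proof. by rewrite -init_sinv -(cov_sinv cA) (cov_init cA) init_sinv. Qed.

Lemma walk_image p w q :
  walk p w q -> walk (on_point A p) (on_path A w) (on_point A q).
Proof.
elim: w p => [|s w IH] p /=; first by move/eqP->.
by move=> /andP[/eqP<- /IH]; rewrite (cov_init cA) eqxx cov_final.
Qed.

Lemma walk_inj p w1 q1 w2 q2 :
  walk p w1 q1 -> walk p w2 q2 -> on_path A w1 = on_path A w2 -> w1 = w2.
Proof.
elim: w1 w2 p => [|s w1 IH] [|t w2] p //= /andP[/eqP is1 h1].
move=> /andP[/eqP it1 h2] [e12 /IH e].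
have [x [_ xu]] : exists! x, init x = p /\ on_segment A x = on_segment A s.
  by apply: (cov_star cA); rewrite (cov_init cA) is1.
have est : s = t by rewrite -(xu s) ?(xu t).
by rewrite -est in h2 *; congr cons; apply: e h1 h2.
Qed.

Lemma walk_lift p (v : seq (segment D)) (q' : point D) :
  walk (on_point A p) v q' -> exists w q, walk p w q /\ on_path A w = v.
Proof.
elim: v p => [|s v IH] p /=; first by exists [::], p => /=.
move=> /andP[/eqP is1 h].
have [t [[it1 et] _]] := cov_star cA is1.
have [|w [q [hw ew]]] := IH (final t); first by rewrite -cov_final et.
by exists (t :: w), q; rewrite /= it1 eqxx et ew.
Qed.

(** All boundary paths of a piece have the same length, so the one whose power
    is the image of [r] is the one with which that image starts. *)
Lemma boundary_factor f r r' :
  spb f r -> spb (on_piece A f) r' -> prefix r' (on_path A r) ->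
  exists ws, [/\ 0 < size ws, r = flatten ws,
                 {in ws, forall w, on_path A w = r'} & uniq ws].
Proof.
move=> fr fr' pr; have [r0 [k [fr0 _ [ws [_ er ews uws]]]]] := cov_boundary cA fr.
case: ws er ews uws => [er|w ws er ews uws].
  by have := spb_nonempty fr; rewrite er.
suff er0 : r0 = r' by exists (w :: ws); split; rewrite // -er0.
move: pr; rewrite prefixE er /on_path /= map_cat.
rewrite -[map _ w]/(on_path A w) ews ?mem_head //.
by rewrite (spb_size fr' fr0) take_size_cat // => /eqP.
Qed.

Lemma on_path_flatten (ws : seq (seq (segment C))) r :
  {in ws, forall w, on_path A w = r} ->
  on_path A (flatten ws) = path_pow r (size ws).
Proof.
elim: ws => //= w ws IH h; rewrite /on_path map_cat -/(on_path A w) h ?mem_head //.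
by congr cat; apply: IH => v hv; apply: h; rewrite in_cons hv orbT.
Qed.

Lemma boundary_power f r r' :
  spb f r -> spb (on_piece A f) r' -> prefix r' (on_path A r) ->
  exists k, on_path A r = path_pow r' k.
Proof.
move=> h1 h2 h3; have [ws [_ -> h _]] := boundary_factor h1 h2 h3.
by exists (size ws); apply: on_path_flatten.
Qed.

Lemma unbranched_boundary f r :
  ~ branched A -> spb f r -> spb (on_piece A f) (on_path A r).
Proof.
move=> nb fr; have [r0 [k [fr0 er _]]] := cov_boundary cA fr.
case: k er => [|[|n]] er.
- by have := spb_nonempty fr; case: r {fr} er.
- by rewrite er /path_pow /= cats0.
- by case: nb; exists f, n.+1; split=> //; exists r, r0; split.
Qed.

End Lifting.

(** * Composition with an unbranched covering *)

Section Composition.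

Variables (K C D : surface_complex).
Variables (A : complex_map C D) (B : complex_map K C).
Hypotheses (cA : covering A) (cB : covering B) (nbB : ~ branched B).

Lemma on_path_comp w : on_path (comp_map A B) w = on_path A (on_path B w).
Proof. by rewrite /on_path -map_comp. Qed.

Lemma comp_star p s' : init s' = on_point (comp_map A B) p ->
  exists! s, init s = p /\ on_segment (comp_map A B) s = s'.
Proof.
move=> /= hs'; have [t [[it1 et] ut]] := cov_star cA hs'.
have [s [[is1 es] us]] := cov_star cB it1.
exists s; split=> [|x [ix ex]] /=; first by rewrite es.
by apply: us; split=> //; apply/esym/ut; rewrite (cov_init cB) ix.
Qed.

Lemma comp_boundary f r : spb f r ->
  exists r' k, [/\ spb (on_piece (comp_map A B) f) r',
    on_path (comp_map A B) r = path_pow r' k &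
    exists ws : seq (seq (segment K)),
      [/\ size ws = k, r = flatten ws,
          {in ws, forall w, on_path (comp_map A B) w = r'} & uniq ws]].
Proof.
move=> fr; have fBr := unbranched_boundary cB nbB fr.
have [r' [k [h1 h2 [ws [h3 h4 h5 h6]]]]] := cov_boundary cA fBr.
exists r', k; split=> //; first by rewrite on_path_comp.
(* cut [r] at the places where its image [flatten ws] is cut *)
have ews : map (on_path B) (reshape (shape ws) r) = ws.
  by rewrite /on_path map_reshape -/(on_path B r) h4 flattenK.
exists (reshape (shape ws) r); split.
- by rewrite size_reshape size_map.
- by rewrite reshapeKr // -size_flatten -h4 size_map.
- move=> w hw; rewrite on_path_comp; apply: h5.
  by rewrite -ews; apply: map_f.
- by apply: (@map_uniq _ _ (on_path B)); rewrite ews.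
Qed.

Lemma comp_lift g r' w :
  spb g r' -> is_path w -> on_path (comp_map A B) w = r' ->
  exists! f, on_piece (comp_map A B) f = g /\ exists r, spb f r /\ prefix w r.
Proof.
move=> gr' [p [q hw]] ew; rewrite on_path_comp in ew.
have wn0 : w != [::].
  by apply/eqP=> w0; have := spb_nonempty gr'; rewrite -ew w0.
have [f [[ef [r [fr pr]]] uf]] :
    exists! f, on_piece A f = g /\ exists r, spb f r /\ prefix (on_path B w) r.
  apply: (cov_lift cA gr') ew; exists (on_point B p), (on_point B q).
  exact: walk_image.
(* [w ++ v] is the lift of [r] that extends [w] *)
have [v [x [hv ev]]] : exists v x, walk q v x /\ on_path B (w ++ v) = r.
  move/prefixP: pr fr => [v0 ->] fr.
  have [p0 /walk_cat[m0 m1 m2]] := spb_closed fr.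
  have eq0 : m0 = on_point B q.
    have Bn0 : on_path B w != [::] by case: (w) wn0.
    have ep := walk_init Bn0 m1 (walk_image cB hw).
    by move: m1; rewrite ep => m1; apply: walk_final m1 (walk_image cB hw).
  rewrite eq0 in m2; have [v [y [hv ev]]] := walk_lift cB m2.
  by exists v, y; split=> //; rewrite /on_path map_cat; congr cat.
have hwv : walk p (w ++ v) x by apply/walk_cat; exists q.
have [f' [[ef' [r1 [fr1 pr1]]] uf']] :
    exists! f', on_piece B f' = f /\ exists r, spb f' r /\ prefix (w ++ v) r.
  by apply: (cov_lift cB fr) ev; exists p, x.
exists f'; split=> [|h [eh [r2 [hr2 pr2]]]].
  split; first by rewrite /= ef'.
  by exists r1; split=> //; apply: prefix_trans pr1; apply: prefix_prefix.
have pB : prefix (on_path B w) (on_path B r2).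
  by move/prefixP: pr2 => [y ->]; rewrite /on_path map_cat prefix_prefix.
have fBr2 := unbranched_boundary cB nbB hr2.
have efh : on_piece B h = f.
  by apply/esym/uf; split=> //; exists (on_path B r2).
apply: uf'; split=> //; exists r2; split=> //.
rewrite efh in fBr2.
(* [r] and the image of [r2] are boundary paths of [f] with the same first
   point and the same image: powers of [r'] of equal length *)
have pow z : spb f z -> prefix (on_path B w) z ->
    exists k, on_path A z = path_pow r' k.
  move=> fz pz; apply: (boundary_power cA fz); first by rewrite ef.
  by rewrite -ew; move/prefixP: pz => [y ->]; rewrite /on_path map_cat prefix_prefix.
have [k ek] := pow _ fr pr; have [k2 ek2] := pow _ fBr2 pB.
have ekk : k = k2.
  have : size (on_path A r) = size (on_path A (on_path B r2)).
    by rewrite !(size_map (on_segment A)) (spb_size fr fBr2).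
  rewrite ek ek2 !size_path_pow => /eqP; rewrite eqn_pmul2r => [/eqP //|].
  by rewrite lt0n size_eq0 (spb_nonempty gr').
suff -> : w ++ v = r2 by apply: prefix_refl.
have [a ha] := spb_closed hr2.
have hpa : walk p r2 a.
  move/prefixP: pr2 ha => [y ->] /walk_cat[b b1 b2].
  by rewrite (walk_init wn0 hw b1); apply/walk_cat; exists b.
apply: (walk_inj cB hwv hpa).
have /(walk_inj cA) H := walk_image cB hwv.
apply: H (walk_image cB hpa) _.
by rewrite ev ek ek2 ekk.
Qed.

Lemma comp_covering : covering (comp_map A B).
Proof.
split.
- move=> q; have [p <-] := cov_surj cA q; have [o <-] := cov_surj cB p.
  by exists o.
- by move=> s /=; rewrite (cov_init cA) (cov_init cB).
- by move=> s /=; rewrite (cov_sinv cB) (cov_sinv cA).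
- by move=> f /=; rewrite (cov_pinv cB) (cov_pinv cA).
- exact: comp_star.
- exact: comp_boundary.
- exact: comp_lift.
Qed.

End Composition.

(** * Transport of homotopies along a regular covering *)

Section Regular.

Variables (C D : surface_complex) (A : complex_map C D).
Hypotheses (cA : covering A) (rA : regular A).
Implicit Types (p q : point C) (w u v : seq (segment C)).

Lemma regular_walk p w p' w' q' :
  walk p w p -> walk p' w' q' -> on_path A w = on_path A w' -> q' = p'.
Proof.
move=> hw hw' e.
have [] : closed_path w'.
  by apply: rA e _; [exists p, p|exists p', q'|exists p].
case: w' hw' {e} => [/eqP-> //|s w'] hw' x hx.
have ex : x = p' by apply: walk_init hx hw'.
by rewrite ex in hx; apply: walk_final hw' hx.
Qed.

(** Otherwise the first [size vs] factors of [ws], having the same image as the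
    closed path [flatten vs], form a closed path by regularity; then the next
    factor of [ws] lifts [r] from the same point as the first one and repeats
    it. *)
Lemma regular_turns r ws p vs p' :
  uniq ws -> 0 < size vs ->
  {in ws, forall w, on_path A w = r} -> {in vs, forall w, on_path A w = r} ->
  walk p (flatten ws) p -> walk p' (flatten vs) p' -> size ws <= size vs.
Proof.
move=> uws vs0 ews evs hws hvs; rewrite leqNgt; apply/negP => lt.
set j := size vs in vs0 lt.
case ed : (drop j ws) => [|x ds].
  by have := size_drop j ws; rewrite ed => /esym/eqP; rewrite subn_eq0 leqNgt lt.
case et : (take j ws) => [|y ts].
  by have := size_takel (ltnW lt); rewrite et => /= j0; rewrite -j0 in vs0.
have ews' : ws = (y :: ts) ++ (x :: ds) by rewrite -et -ed cat_take_drop.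
have xin : x \in ws by rewrite ews' mem_cat mem_head orbT.
have yin : y \in ws by rewrite ews' mem_cat mem_head.
move: hws; rewrite {1}ews' flatten_cat => /walk_cat[m h1 h2].
have em : m = p.
  apply: (regular_walk hvs h1); rewrite -et (on_path_flatten evs).
  rewrite (@on_path_flatten _ _ A _ r) ?size_takel ?(ltnW lt) //.
  by move=> w /mem_take; apply: ews.
rewrite em in h2.
move: h1 h2 => /= /walk_cat[a a1 _] /walk_cat[b b1 _].
have exy : x = y by apply: (walk_inj cA b1 a1); rewrite !ews.
move: uws; rewrite ews' cat_uniq exy => /and3P[_ /hasPn/(_ y (mem_head _ _)) + _].
by rewrite /= mem_head.
Qed.

(** The piece provided by the lifting condition along the first turn of [r'] has
    a boundary path making as many turns as [r], hence equal to [r']. *)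
Lemma regular_boundary f r p' r' q' :
  spb f r -> walk p' r' q' -> on_path A r' = on_path A r ->
  exists f', spb f' r'.
Proof.
move=> fr hr' e; have [r0 [k [fr0 ek [ws [sws er ews uws]]]]] := cov_boundary cA fr.
have ws0 : 0 < size ws.
  by case: (ws) er => // er; have := spb_nonempty fr; rewrite er.
have r00 := spb_nonempty fr0.
pose u := take (size r0) r'.
have ekp : on_path A r = r0 ++ path_pow r0 k.-1.
  by rewrite ek -sws; case: (size ws) ws0.
have eu : on_path A u = r0.
  by rewrite /u /on_path map_take -/(on_path A r') e ekp take_size_cat.
have un0 : u != [::] by apply/eqP=> u0; rewrite u0 in eu; rewrite -eu in r00.
have [b hu] : exists b, walk p' u b.
  by move: hr'; rewrite -{1}(cat_take_drop (size r0) r') => /walk_cat[b]; exists b.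
have hpu : is_path u by exists p', b.
have [f' [[ef' [r1 [fr1 pr1]]] _]] := cov_lift cA fr0 hpu eu.
exists f'; suff -> : r' = r1 by [].
have [vs [vs0 er1 evs uvs]] :
    exists ws, [/\ 0 < size ws, r1 = flatten ws,
                   {in ws, forall w, on_path A w = r0} & uniq ws].
  apply: (boundary_factor cA fr1); first by rewrite ef'.
  by move/prefixP: pr1 => [y ->]; rewrite /on_path map_cat -/(on_path A u) eu prefix_prefix.
have [p hr] := spb_closed fr; have [p1 hr1] := spb_closed fr1.
have ep1 : p1 = p'.
  move/prefixP: pr1 hr1 => [y ->] /walk_cat[c c1 _].
  exact: walk_init c1 hu.
rewrite ep1 in hr1.
apply: (walk_inj cA hr' hr1); rewrite e ek -sws er1 (on_path_flatten evs).
congr path_pow; rewrite er in hr; rewrite er1 in hr1.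
apply/eqP; rewrite eqn_leq.
by rewrite (regular_turns uws vs0 ews evs hr hr1) (regular_turns uvs ws0 evs ews hr1 hr).
Qed.

Lemma path_image_cat (w u v : seq (segment C)) :
  on_path A w = on_path A (u ++ v) ->
  exists u' v', [/\ w = u' ++ v', on_path A u' = on_path A u &
                    on_path A v' = on_path A v].
Proof.
rewrite {2}/on_path map_cat => e.
exists (take (size u) w), (drop (size u) w); rewrite cat_take_drop.
rewrite /on_path map_take map_drop -/(on_path A w) e.
by rewrite take_size_cat ?drop_size_cat ?size_map.
Qed.

Lemma elementary_move_transport p p' w1 w2 w1' w2' :
  elementary_move p w1 w2 ->
  walk p' w1' p' -> walk p' w2' p' ->
  on_path A w1' = on_path A w1 -> on_path A w2' = on_path A w2 ->
  elementary_move p' w1' w2'.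
Proof.
move=> [h1 h2 ins] h1' h2' e1 e2; split=> //.
(* an inserted closed path [t] lifts to a closed path [t'], so that removing
   [t'] from [w2'] leaves [w1'] *)
have key u v t x : w1 = u ++ v -> w2 = u ++ t ++ v -> walk x t x ->
    exists u' t' v' y, [/\ w1' = u' ++ v', w2' = u' ++ t' ++ v', walk y t' y &
       on_path A t' = on_path A t].
  move=> ew1 ew2 ht; rewrite ew1 in e1; rewrite ew2 in e2.
  have [u' [z [ew2' eu' /path_image_cat[t' [v' [ez et' ev']]]]]] := path_image_cat e2.
  move: h2'; rewrite ew2' ez => /walk_cat[y hu /walk_cat[y' hy hv]].
  have ey := regular_walk ht hy (esym et'); rewrite ey in hy hv.
  exists u', t', v', y; split=> //.
  have huv : walk p' (u' ++ v') p' by apply/walk_cat; exists y.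
  apply: (walk_inj cA h1' huv).
  by rewrite e1 /on_path !map_cat; congr cat; apply/esym.
move ew1 : w1 ins => x1 ins; move ew2 : w2 ins => x2 ins.
case: ins ew1 ew2 => [u v s|u v f r fr] ew1 ew2.
  have [|u' [t' [v' [y [-> -> hy ey]]]]] := key _ _ _ (init s) ew1 ew2.
    by rewrite /= init_sinv final_sinv !eqxx.
  suff [s' ->] : exists s', t' = [:: s'; sinv s'] by constructor.
  case: t' hy ey => [|s1 [|s2 [|s3 t']]] //= /andP[_ hy] [ea eb].
  exists s1; congr cons.
  have hy' : walk (final s1) [:: sinv s1] (init s1).
    by rewrite /= init_sinv final_sinv !eqxx.
  apply: (walk_inj cA (hy : walk (final s1) [:: s2] y) hy').
  by rewrite /= eb !(cov_sinv cA) ea.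
have [x hx] := spb_closed fr.
have [u' [t' [v' [y [-> -> hy ey]]]]] := key _ _ _ _ ew1 ew2 hx.
have [f' ft'] := regular_boundary fr hy ey.
exact: InsertBoundary ft'.
Qed.

Lemma homotopic_walk p w1 w2 :
  homotopic p w1 w2 -> walk p w1 p <-> walk p w2 p.
Proof.
by elim=> [x y []|x|x y _ []|x y z _ [h1 h1'] _ [h2 h2']] //; split; auto.
Qed.

(** The intermediate closed paths of a homotopy at [p] lift to paths at [p'],
    which are closed by regularity. *)
Lemma homotopic_transport p p' w1 w2 w1' w2' :
  on_point A p' = on_point A p -> homotopic p w1 w2 -> walk p w1 p ->
  walk p' w1' p' -> walk p' w2' p' ->
  on_path A w1' = on_path A w1 -> on_path A w2' = on_path A w2 ->
  homotopic p' w1' w2'.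
Proof.
move=> ep h; elim: h w1' w2' => {w1 w2}.
- move=> x y mv w1' w2' _ h1 h2 e1 e2; apply: rst_step.
  exact: elementary_move_transport mv h1 h2 e1 e2.
- move=> x w1' w2' _ h1 h2 e1 e2.
  by rewrite (walk_inj cA h1 h2) ?e1 ?e2 //; apply: rst_refl.
- move=> x y hxy IH w1' w2' hy h1 h2 e1 e2.
  by apply: rst_sym; apply: IH => //; apply/(homotopic_walk hxy).
- move=> x y z hxy IH1 hyz IH2 w1' w2' hx h1 h2 e1 e2.
  have hy : walk p y p by apply/(homotopic_walk hxy).
  have /(walk_lift cA)[y' [q [hy' ey']]] :
      walk (on_point A p') (on_path A y) (on_point A p).
    by rewrite ep; apply: walk_image.
  have eq := regular_walk hy hy' (esym ey'); rewrite eq in hy'.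
  by apply: (rst_trans _ _ _ y'); [apply: IH1|apply: IH2].
Qed.

Lemma represents_identity_transport w w' :
  is_path w' -> on_path A w' = on_path A w ->
  represents_identity w -> closed_path w' /\ represents_identity w'.
Proof.
move=> [p' [q' hw']] e [p [hw hom]].
have [w0|wn0] := eqVneq w [::].
  (* an empty path does not determine the point at which it starts *)
  have -> : w' = [::] by apply: size0nil; rewrite -(size_map (on_segment A)) -/(on_path A w') e w0.
  by split; exists p' => //=; split=> //; apply: rst_refl.
have eq := regular_walk hw hw' (esym e); rewrite eq in hw'.
split; exists p' => //; split=> //.
have ep : on_point A p' = on_point A p.
  have An0 : on_path A w != [::] by case: (w) wn0.
  have := walk_image cA hw'; rewrite e => h.
  exact: walk_init An0 h (walk_image cA hw).
by apply: (homotopic_transport ep hom) => //=.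
Qed.

End Regular.

Theorem mainTheorem2 (C Cs K : surface_complex)
    (A : complex_map C Cs) (A' : complex_map K C) :
  connected C -> bounds_uniquely Cs ->
  covering A -> regular A ->
  universal_covering A' ->
  covering (comp_map A A') /\ regular (comp_map A A').
Proof.
move=> _ _ cA rA [_ cB nbB uB]; split; first exact: comp_covering.
move=> w w' pw pw'; rewrite !on_path_comp => e cw.
apply/(uB _ pw'); have [_ idw] := (uB _ pw).1 cw.
apply: (represents_identity_transport cA rA _ (esym e) idw).
have [p [q h]] := pw'.
by exists (on_point A' p), (on_point A' q); apply: walk_image.
Qed.
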